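(* For a general graph $G=(V,E)$ (and any destination $t\in V$), there exists a $1$-resilient routing scheme against dynamic failures.
   Context: Graphs are finite undirected (multi)graphs, with no connectivity assumption beyond what is stated. Dynamic failures: a set $F\subseteq E$ of unstable links; each link of $F$ may alternate arbitrarily between up and down over time (when down it fails in both directions), including while a packet travels; links outside $F$ are always up. Routing scheme: for destination $t$, every node $v\ne t$ has a static deterministic forwarding function whose input is the in-port of the packet (or $\bot$ if the packet originates at $v$) and the set of links incident to $v$ that are currently up, and whose output is an outgoing link at $v$. No packet header rewriting and no knowledge of the source is used. A routing scheme for $t$ is $k$-resilient against dynamic failures if for every set $F$ of dynamic failures with $|F|\le k$, every packet originating at a node $s$ that is connected to $t$ in $G\setminus F$ (the graph with all of $F$ removed) is delivered to $t$, however the states of the links of $F$ evolve. Non-trap assumption (standing): it is assumed that the dynamic failures in $F$ cannot lead the routing functions to direct a packet across different connected components of $G\setminus F$. *)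

(* Defs.v *)
From HB Require Import structures.
From mathcomp Require Import all_boot.

Set Implicit Arguments.
Unset Strict Implicit.
Unset Printing Implicit Defensive.

(* Links are abstract objects, so parallel links (and loops) are allowed.
   The order of the two components of [ends e] carries no meaning: every
   notion below treats them symmetrically. *)
Record multigraph := Multigraph {
  vertex : finType;
  link : finType;
  ends : link -> vertex * vertex
}.

Section Graph.

Variable G : multigraph.
Implicit Types (u v s t : vertex G) (e : link G) (F : {set link G}).

Definition incident v e : bool := (v == (ends e).1) || (v == (ends e).2).

Definition links_at v : {set link G} := [set e | incident v e].

(* Only meaningful when [e] is incident to [v]; a loop leads back to [v]. *)
Definition other_end v e : vertex G :=
  if v == (ends e).1 then (ends e).2 else (ends e).1.

Definition adjacent_avoiding F : rel (vertex G) :=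
  fun u v => [exists e, [&& e \notin F, incident u e & other_end u e == v]].

Definition connected_avoiding F : rel (vertex G) :=
  connect (adjacent_avoiding F).

End Graph.

(* [forward v i U]: the in-port [i] is [None] for a packet originating at [v]
   and [Some e] for a packet that arrived over [e]; [U] is the set of links
   incident to [v] that are currently up.  The output is one of the links in
   [U]; it is [None] exactly when [U] is empty.  Nothing is required of
   [forward] outside its intended domain. *)
Record routing_scheme (G : multigraph) (t : vertex G) := RoutingScheme {
  forward : vertex G -> option (link G) -> {set link G} -> option (link G);
  forwardP : forall (v : vertex G) (i : option (link G)) (U : {set link G}),
    v != t -> (if i is Some e then incident v e else true) ->
    U \subset links_at v ->
    if forward v i U is Some e then e \in U else U == set0
}.

Section Dynamics.

Variables (G : multigraph) (t : vertex G) (R : routing_scheme t).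
Implicit Types (s v : vertex G) (F : {set link G}) (up : nat -> {set link G}).

(* [up n] is the set of links that are up when the packet is about to make its
   [n]-th forwarding step; since it is arbitrary on [F], any number of state
   changes may happen between two steps. *)
Definition dynamic_failures F up : Prop := forall n, ~: F \subset up n.

(* A packet is represented by its current node and its in-port there.
   A packet that finds every incident link down waits. *)
Definition step (U : {set link G}) (p : vertex G * option (link G)) :
    vertex G * option (link G) :=
  let: (v, i) := p in
  if v == t then p
  else if forward R v i (U :&: links_at v) is Some e
       then (other_end v e, Some e)
       else p.

Fixpoint packet up s n : vertex G * option (link G) :=
  if n is m.+1 then step (up m) (packet up s m) else (s, None).

Definition delivered up s : Prop := exists n, (packet up s n).1 = t.

Definition resilient (k : nat) : Prop :=
  forall F, #|F| <= k ->
  forall s, connected_avoiding F s t ->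
  forall up, dynamic_failures F up -> delivered up s.

(* The failing links cannot lead a packet into another connected component of
   the graph without [F].  Sources not connected to [t] have to be excluded:
   if [F] consists of a bridge that happens to be up, a packet from the far
   side of that bridge must be allowed to cross it. *)
Definition non_trap (k : nat) : Prop :=
  forall F, #|F| <= k ->
  forall s, connected_avoiding F s t ->
  forall up, dynamic_failures F up ->
  forall n, connected_avoiding F s (packet up s n).1.

End Dynamics.

(* Main.v *)
(* The component of [t] carries two spanning trees directed to [t] in which a
   vertex has the same outgoing link in both trees only if that link separates
   it from [t].  They are grown by ears: the inner vertices of an ear leave it
   through one end in the first tree and through the other end in the second;
   when no ear starts with a link that leaves the tree vertices, this link is a
   bridge and both trees use it.  A packet follows one tree, recognised from the
   in-port, and changes tree when its next link is down.  If the failing link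
   joins [p] and [q], the packet changes tree at [p], possibly again at [q], and
   then is past [p] on its first tree.  Crossing a bridge may also put the packet
   back on the first tree, but decreases a depth that never grows. *)
Require Import Defs.
From HB Require Import structures.
From mathcomp Require Import all_boot.

Set Implicit Arguments.
Unset Strict Implicit.
Unset Printing Implicit Defensive.

(** * Links and connectivity in a multigraph *)

Section Links.

Variable G : multigraph.
Implicit Types (u v : vertex G) (e : link G) (F : {set link G}).

Lemma incident_other_end v e : incident v e -> incident (other_end v e) e.
Proof.
by rewrite /incident /other_end; case: (v == _); rewrite eqxx ?orbT.
Qed.

Lemma other_endK v e : incident v e -> other_end (other_end v e) e = v.
Proof.
rewrite /incident /other_end; case: eqP => [-> _|_ /= /eqP->]; last by rewrite eqxx.
by case: eqP.
Qed.

Lemma incident_cases u v e :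
  incident u e -> incident v e -> v = u \/ v = other_end u e.
Proof.
rewrite /incident /other_end.
case: eqP => [-> _|_ /= /eqP->] /orP[]/eqP->; auto.
Qed.

Lemma adjacent_other_end F v e :
  e \notin F -> incident v e -> adjacent_avoiding F v (other_end v e).
Proof. by move=> eF ve; apply/existsP; exists e; rewrite eF ve eqxx. Qed.

Lemma adjacent_avoiding_sym F : symmetric (adjacent_avoiding F).
Proof.
suff half u v : adjacent_avoiding F u v -> adjacent_avoiding F v u.
  by move=> u v; apply/idP/idP; apply: half.
case/existsP=> e /and3P[eF ue /eqP<-].
by rewrite -{2}(other_endK ue) adjacent_other_end ?incident_other_end.
Qed.

Lemma connected_avoiding_sym F : symmetric (connected_avoiding F).
Proof. exact/sym_connect_sym/adjacent_avoiding_sym. Qed.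

Lemma connected_other_end F v e t :
  e \notin F -> incident v e ->
  connected_avoiding F (other_end v e) t = connected_avoiding F v t.
Proof.
move=> eF ve; have /connect1 vw := adjacent_other_end eF ve.
exact/esym/(same_connect (sym_connect_sym (@adjacent_avoiding_sym F))).
Qed.

End Links.

(** * Construction of the two trees by ears and bridges *)

Section TwinTrees.

Variables (G : multigraph) (t : vertex G).
Implicit Types (S : {set vertex G}) (nxt : bool -> vertex G -> option (link G)).
Implicit Types (rk : bool -> vertex G -> nat) (dp : vertex G -> nat).
Implicit Types (u v : vertex G) (e : link G) (F : {set link G}) (j : bool).

Definition good_link S rk dp j v e : Prop :=
  [/\ incident v e, other_end v e \in S, rk j (other_end v e) < rk j v
    & dp (other_end v e) <= dp v].

(* [nxt j v] is the link on which [v] leaves towards [t] in tree [j]; the ranks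
   witness acyclicity, and the depth strictly decreases over shared links. *)
Record twin_trees S nxt rk dp : Prop := TwinTrees {
  root_in : t \in S;
  nxtP : forall j v, v \in S -> v != t ->
    exists2 e, nxt j v = Some e & good_link S rk dp j v e;
  sharedP : forall v e, v \in S -> v != t ->
    nxt false v = Some e -> nxt true v = Some e ->
    ~~ connected_avoiding [set e] v t /\ dp (other_end v e) < dp v
}.

Definition patch (A : Type) S (f g : vertex G -> A) v :=
  if v \in S then f v else g v.

(** Links chosen at old vertices lead from [S] into [S], where [patch] keeps all values, so only the
    new vertices have to be checked. *)
Lemma twin_trees_extend S S' nxt rk dp nxt' rk' dp' :
  let n j := patch S (nxt j) (nxt' j) in
  let r j := patch S (rk j) (rk' j) in
  let d := patch S dp dp' in
  twin_trees S nxt rk dp -> S \subset S' ->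
  (forall j v, v \in S' -> v \notin S ->
    exists2 e, nxt' j v = Some e & good_link S' r d j v e) ->
  (forall v e, v \in S' -> v \notin S ->
    nxt' false v = Some e -> nxt' true v = Some e ->
    ~~ connected_avoiding [set e] v t /\ d (other_end v e) < d v) ->
  twin_trees S' n r d.
Proof.
move=> n r d T sSS' newP newS; split=> [|j v vS' vt|v e vS' vt].
- exact: (subsetP sSS') (root_in T).
- have [vS|vS] := boolP (v \in S); last by rewrite /n /patch (negPf vS); apply: newP.
  have [e ne [ve wS rw dw]] := nxtP T j vS vt.
  exists e; first by rewrite /n /patch vS.
  by split; rewrite /r /d /patch ?vS ?wS // (subsetP sSS').
have [vS|vS] := boolP (v \in S); last by rewrite /n /patch (negPf vS); apply: newS.
rewrite {1 2}/n {1 2}/patch vS => n0 n1.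
have [conn ltd] := sharedP T vS vt n0 n1.
have [_ [<-] [_ wS _ _]] : exists2 e', Some e = Some e' & good_link S rk dp true v e'.
  by rewrite -n1; apply: nxtP T _ _ vS vt.
by rewrite /d /patch vS wS.
Qed.

(** Both trees leave the new vertex over [e], which [sharedP] allows because [e] separates it from
    [t]; its depth is one more than that of [a]. *)
Lemma add_bridge S nxt rk dp a e :
  twin_trees S nxt rk dp -> a \in S -> incident a e ->
  other_end a e \notin S ->
  ~~ connected_avoiding [set e] (other_end a e) t ->
  exists S' nxt' rk' dp', twin_trees S' nxt' rk' dp' /\ S \proper S'.
Proof.
move=> T aS ae; set x := other_end a e => xS bridge.
have xa : other_end x e = a by apply: other_endK.
exists (x |: S).
do 3 eexists; split; last first.
  by rewrite properE subsetUr; apply/subsetPn; exists x; rewrite ?setU11.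
apply: (twin_trees_extend (nxt' := fun _ _ => Some e)
  (rk' := fun j _ => (rk j a).+1) (dp' := fun _ => (dp a).+1) T (subsetUr _ _)).
  move=> j v; rewrite in_setU1 => /predU1P[->|->] // _.
  exists e => //; split; rewrite ?incident_other_end // xa /patch ?aS ?(negPf xS) //.
  by rewrite in_setU1 aS orbT.
move=> v e'; rewrite in_setU1 => /predU1P[->|->] // _ [<-] _.
by rewrite xa /patch aS (negPf xS).
Qed.

(** A simple path from the new vertex to [t] that avoids [e] is cut at its first vertex [f k] in
    [S]. Together with [e] this is an ear with ends [a] and [f k], possibly equal. *)
Lemma add_ear S nxt rk dp a e :
  twin_trees S nxt rk dp -> a \in S -> incident a e ->
  other_end a e \notin S ->
  connected_avoiding [set e] (other_end a e) t ->
  exists S' nxt' rk' dp', twin_trees S' nxt' rk' dp' /\ S \proper S'.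
Proof.
move=> T aS ae; set x := other_end a e => xS /connectP[p0 pth0 tlast].
have xa : other_end x e = a by apply: other_endK.
have tS := root_in T.
case: (shortenP pth0) tlast => p pth uniqs _ tlast {p0 pth0}.
set s := x :: p in uniqs.
have hasS : has (mem S) s by apply/hasP; exists t; rewrite // tlast mem_last.
pose k := find (mem S) s; pose f := nth t s.
have ks : k < size s by rewrite -has_find.
have fkS : f k \in S by apply: (nth_find t hasS).
have k_gt0 : 0 < k by rewrite /k /= (negPf xS).
have fS i : i < k -> f i \notin S by move=> ik; apply/negbT/(before_find t ik).
pose L u v := [pick l | [&& l \notin [set e], incident u l & other_end u l == v]].
have LP i : i < k -> exists2 l, L (f i) (f i.+1) = Some l &
    [/\ l != e, incident (f i) l & other_end (f i) l = f i.+1].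
  move=> ik; have /existsP[l0 Pl0] : adjacent_avoiding [set e] (f i) (f i.+1).
    by apply: (pathP t pth); apply: leq_trans ik _.
  rewrite /L; case: pickP => [l|/(_ l0)]; last by rewrite Pl0.
  by rewrite in_set1 => /and3P[? ? /eqP ?]; exists l.
pose id v := index v s.
have idf i : i <= k -> id (f i) = i.
  by move=> ik; apply: index_uniq => //; apply: leq_ltn_trans ks.
have fid v : id v < k -> f (id v) = v.
  by move=> vk; apply: nth_index; rewrite -index_mem; apply: ltn_trans ks.
(* Tree [true] runs forward to [f k], tree [false] back to [a] over the same inner links; the ranks
   add the number of steps to that end. *)
pose n' j v := if j then L v (f (id v).+1)
               else if id v == 0 then Some e else L (f (id v).-1) v.
pose r' j v := if j then rk true (f k) + (k - id v) else rk false a + (id v).+1.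
(* A constant that dominates both ends, so that depth rises in neither direction. *)
pose d' := fun _ : vertex G => maxn (dp a) (dp (f k)).
pose S' := S :|: [set v | id v < k].
have newE v : v \in S' -> v \notin S -> id v < k.
  by rewrite !inE => /orP[->|].
have fS' i : i <= k -> f i \in S'.
  by rewrite !inE leq_eqVlt => /predU1P[->|ik]; rewrite ?fkS // idf ?ik ?orbT // ltnW.
have dfE i : i <= k -> patch S dp d' (f i) <= maxn (dp a) (dp (f k)).
  rewrite /patch leq_eqVlt => /predU1P[->|ik]; first by rewrite fkS leq_maxr.
  by rewrite (negPf (fS _ ik)).
exists S'; do 3 eexists; split; last first.
  rewrite properE subsetUl; apply/subsetPn; exists x => //.
  by rewrite !inE /id /= eqxx k_gt0 orbT.
apply: (twin_trees_extend (nxt' := n') (rk' := r') (dp' := d') T (subsetUl _ _)).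
  move=> j v vS' vS; have ik := newE _ vS' vS; have vE := fid _ ik.
  rewrite -{}vE; move: (id v) ik => i ik {v vS' vS}.
  case: j.
    have [l Ll [le vl wl]] := LP i ik; have ik' := ltnW ik.
    exists l; first by rewrite /n' (idf i ik') Ll.
    split; rewrite ?wl ?fS' //; last by rewrite {2}/patch (negPf (fS _ ik)) dfE.
    rewrite /patch (negPf (fS _ ik)) /r' (idf i ik').
    have := ik; rewrite leq_eqVlt => /predU1P[ik1|ik1].
      by rewrite ik1 fkS -[X in X < _]addn0 ltn_add2l subn_gt0.
    by rewrite (negPf (fS _ ik1)) (idf _ ik) ltn_add2l ltn_sub2l.
  case: i ik => [|i] ik.
    exists e; first by rewrite /n' idf.
    rewrite -[f 0]/x; split; rewrite ?xa.
    - exact: incident_other_end.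
    - by rewrite inE aS.
    - by rewrite /patch aS (negPf xS) /r' addnS ltnS leq_addr.
    by rewrite /patch aS (negPf xS) leq_maxl.
  have ik' := ltnW ik; have ik2 := ltnW ik'; have [l Ll [le vl wl]] := LP i ik'.
  exists l; first by rewrite /n' (idf _ ik').
  have wl' : other_end (f i.+1) l = f i by rewrite -wl other_endK.
  split; rewrite ?wl' ?fS' //.
  - by rewrite -wl incident_other_end.
  - by rewrite /patch !(negPf (fS _ _)) // /r' (idf _ ik') (idf _ ik2) ltn_add2l.
  by rewrite {2}/patch (negPf (fS _ ik)) dfE.
(* No ear vertex has a shared exit: the first one has [e] against a link other than [e], and a
   shared link further on would make the simple path return to the vertex two steps before. *)
move=> v l vS' vS; have ik := newE _ vS' vS; have vE := fid _ ik.
rewrite -{}vE; move: (id v) ik => i ik {v vS' vS}.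
have [l1 Ll1 [l1e vl1 wl1]] := LP i ik.
rewrite /n' (idf i (ltnW ik)) Ll1; case: i ik Ll1 vl1 wl1 => [|i] ik Ll1 vl1 wl1 /=.
  by move=> [<-] [l1E]; rewrite l1E eqxx in l1e.
have ik' := ltnW ik; have [l2 Ll2 [l2e vl2 wl2]] := LP i ik'.
rewrite Ll2 => -[<-] [l12]; exfalso.
have fE : f i.+2 = f i by rewrite -wl1 l12 -wl2 other_endK.
have := idf i.+2 ik; rewrite fE (idf i (ltnW ik')) => /eqP.
by rewrite ltn_eqF // ltnW.
Qed.

(** Induction on the number of vertices outside [S], starting from [t] alone. Any link leaving [S]
    yields an ear or a bridge; once there is none, [S] is closed under adjacency. *)
Lemma exists_twin_trees :
  exists S nxt rk dp, twin_trees S nxt rk dp /\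
    forall v, connected_avoiding set0 v t -> v \in S.
Proof.
suff grow c S nxt rk dp : #|~: S| <= c -> twin_trees S nxt rk dp ->
    exists S nxt rk dp, twin_trees S nxt rk dp /\
      forall v, connected_avoiding set0 v t -> v \in S.
  apply: (grow _ [set t] (fun _ _ => None) (fun _ _ => 0) (fun _ => 0) (leqnn _)).
  by split=> [|j v|v e]; rewrite ?in_set1 // => ->.
elim: c S nxt rk dp => [|c IH] S nxt rk dp cS T.
  exists S, nxt, rk, dp; split=> // v _.
  by move: cS; rewrite leqn0 cards_eq0 => /eqP/setP/(_ v); rewrite !inE => /negbFE.
have [/existsP[a /existsP[e /and3P[aS ae xS]]]|closed] := boolP
  [exists a, exists e, [&& a \in S, incident a e & other_end a e \notin S]].
  have [S' [nxt' [rk' [dp' [T' SS']]]]] :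
      exists S' nxt' rk' dp', twin_trees S' nxt' rk' dp' /\ S \proper S'.
    have [conn|bridge] := boolP (connected_avoiding [set e] (other_end a e) t).
      exact: add_ear T aS ae xS conn.
    exact: add_bridge T aS ae xS bridge.
  apply: (IH S' nxt' rk' dp') => //; rewrite -ltnS; apply: leq_trans cS.
  by apply: proper_card; rewrite properC.
exists S, nxt, rk, dp; split=> // v; rewrite connected_avoiding_sym.
case/connectP=> p pth ->; move: (root_in T) pth.
elim: p (t) => //= w p IHp u uS /andP[/existsP[e /and3P[_ ue /eqP wE]]].
apply: IHp; apply: contraR closed => wS; apply/existsP; exists u.
by apply/existsP; exists e; rewrite uS ue wE.
Qed.

End TwinTrees.

(** * The forwarding rule and the two trees *)

Section Routing.

Variables (G : multigraph) (t : vertex G).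
Variables (S : {set vertex G}) (nxt : bool -> vertex G -> option (link G)).
Variables (rk : bool -> vertex G -> nat) (dp : vertex G -> nat).
Hypothesis T : twin_trees t S nxt rk dp.
Implicit Types (u v w : vertex G) (e : link G) (i : option (link G)) (j : bool).

(* A shared link does not tell which tree was followed; then tree [false] is
   taken, as for a packet that originates here. *)
Definition tree_of_port v i : bool :=
  if i is Some e then
    (nxt true (other_end v e) == Some e) && (nxt false (other_end v e) != Some e)
  else false.

Definition twin_forward v i (U : {set link G}) : option (link G) :=
  let usable o := if o is Some e then e \in U else false in
  let j := tree_of_port v i in
  if usable (nxt j v) then nxt j v
  else if usable (nxt (~~ j) v) then nxt (~~ j) v
  (* A scheme must output some link that is up, even where neither tree link is. *)
  else [pick e in U].

Lemma twin_forwardP v i (U : {set link G}) :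
  v != t -> (if i is Some e then incident v e else true) ->
  U \subset links_at v ->
  if twin_forward v i U is Some e then e \in U else U == set0.
Proof.
move=> _ _ _; rewrite /twin_forward.
case: (nxt _ v) => [e|] /=; [case: ifP => // _ |];
  (case: (nxt _ v) => [e'|] /=; [case: ifP => // _ |]);
  by case: pickP => // U0; apply/eqP/setP => l; rewrite U0 inE.
Qed.

Definition twin_scheme : routing_scheme t := RoutingScheme twin_forwardP.

Lemma nxt_good j v e :
  v \in S -> v != t -> nxt j v = Some e -> good_link S rk dp j v e.
Proof. by move=> vS vt ne; have [e'] := nxtP T j vS vt; rewrite ne => -[<-]. Qed.

(** The receiver inspects the choices of the sender [v], so an unshared link reveals its tree even
    if the receiver itself uses it in the other tree. *)
Lemma tree_of_nxt j v e :
  v \in S -> v != t -> nxt j v = Some e -> nxt (~~ j) v != Some e ->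
  tree_of_port (other_end v e) (Some e) = j.
Proof.
move=> vS vt ne ne'; have [ve _ _ _] := nxt_good vS vt ne.
rewrite /tree_of_port other_endK //.
by case: j ne ne' => -> /=; rewrite ?eqxx ?andbF // => /negPf->.
Qed.

Lemma tree_of_nxt_or_dp j v e :
  v \in S -> v != t -> nxt j v = Some e ->
  tree_of_port (other_end v e) (Some e) = j \/ dp (other_end v e) < dp v.
Proof.
move=> vS vt ne.
have [ne'|] := eqVneq (nxt (~~ j) v) (Some e); last by left; apply: tree_of_nxt.
by right; case: j ne ne' => ? ?; have [] := sharedP T vS vt (e := e).
Qed.

(* Ranks exclude that a vertex ranked below [v] in tree [j] leaves over [e], so
   its path in that tree avoids [e]. *)
Lemma connected_past_nxt j v e :
  v \in S -> v != t -> nxt j v = Some e ->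
  connected_avoiding [set e] (other_end v e) t.
Proof.
move=> vS vt ne; have [ve wS rw _] := nxt_good vS vt ne.
suff lower c u : rk j u <= c -> u \in S -> rk j u < rk j v ->
  connected_avoiding [set e] u t by exact: (lower _ _ (leqnn _)).
elim: c u => [|c IH] u uc uS uv; have [->|ut] := eqVneq u t; try exact: connect0.
  by have [e' _ [_ _]] := nxtP T j uS ut; move: uc; rewrite leqn0 => /eqP->.
have [e' ne' [ue' w'S rw' _]] := nxtP T j uS ut.
have e'e : e' != e.
  apply/eqP=> e'E; rewrite {}e'E in ne' ue' w'S rw'.
  case: (incident_cases ve ue') => uE; first by rewrite uE ltnn in uv.
  by move: rw'; rewrite uE other_endK // => /ltn_trans/(_ rw); rewrite ltnn.
rewrite -(@connected_other_end _ _ _ e') ?in_set1 //.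
by apply: IH => //; [rewrite -ltnS (leq_trans rw') | rewrite (ltn_trans rw')].
Qed.

(** * The walk of a packet under at most one failure *)

Section Failure.

Variable F : {set link G}.
Hypothesis F1 : #|F| <= 1.

Lemma failure_set1 e : e \in F -> F = [set e].
Proof. by move=> eF; apply/esym/eqP; rewrite eqEcard sub1set eF cards1. Qed.

(** A link outside [F] preserves connectivity; if [e] is the failing link, the rest of the tree path
    avoids it. This is what keeps packets out of traps. *)
Lemma connected_nxt j v e :
  v \in S -> v != t -> nxt j v = Some e -> connected_avoiding F v t ->
  connected_avoiding F (other_end v e) t.
Proof.
move=> vS vt ne conn; have [ve _ _ _] := nxt_good vS vt ne.
have [eF|eF] := boolP (e \in F); last by rewrite connected_other_end.
by rewrite (failure_set1 eF); apply: connected_past_nxt ne.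
Qed.

Lemma failed_nxt_neq j v f :
  v \in S -> v != t -> connected_avoiding F v t -> f \in F ->
  nxt j v = Some f -> nxt (~~ j) v != Some f.
Proof.
move=> vS vt conn fF nf; apply/eqP=> nf'.
have [/negP[]] : ~~ connected_avoiding [set f] v t /\ dp (other_end v f) < dp v.
  by case: j nf nf' => ? ?; apply: (sharedP T).
by rewrite -(failure_set1 fF).
Qed.

(** If the link of the current tree is down, it is the only failing link, and the link of the other
    tree differs from it and is therefore up. *)
Lemma twin_step v i (U : {set link G}) :
  v \in S -> v != t -> connected_avoiding F v t -> ~: F \subset U ->
  let j := tree_of_port v i in
  exists j' e, [/\ step twin_scheme U (v, i) = (other_end v e, Some e),
    nxt j' v = Some e
    & j' = j \/ j' = ~~ j /\ exists2 f, f \in F & nxt j v = Some f].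
Proof.
move=> vS vt conn upU j.
have [e ne [ve _ _ _]] := nxtP T j vS vt.
have [e' ne' [ve' _ _ _]] := nxtP T (~~ j) vS vt.
rewrite /step (negPf vt) /= /twin_forward -/j ne ne' !inE ve ve' !andbT.
have [eU|eU] := boolP (e \in U); first by exists j, e; split=> //; left.
have eF : e \in F by apply: contraR eU => eF; apply: (subsetP upU); rewrite inE.
have := failed_nxt_neq vS vt conn eF ne; rewrite ne' => e'e.
have e'U : e' \in U.
  by apply: (subsetP upU); rewrite (failure_set1 eF) !inE; apply: contra_neq e'e => ->.
by rewrite e'U; exists (~~ j), e'; split=> //; right; split=> //; exists e.
Qed.

Variables (up : nat -> {set link G}) (s : vertex G).
Hypothesis upF : dynamic_failures F up.

Notation pk := (packet twin_scheme up s).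

Lemma packet_connected n :
  s \in S -> connected_avoiding F s t ->
  (pk n).1 \in S /\ connected_avoiding F (pk n).1 t.
Proof.
move=> sS sconn; elim: n => // n [].
rewrite -[pk n.+1]/(step twin_scheme (up n) (pk n)).
case: (pk n) => v i vS conn.
have [vt|vt] := eqVneq v t.
  by rewrite /step vt eqxx (root_in T); split=> //; apply: connect0.
have [j [e [-> ne _]]] := twin_step i vS vt conn (upF n).
by have [_ wS _ _] := nxt_good vS vt ne; rewrite /= wS (connected_nxt _ _ ne).
Qed.

Hypotheses (sS : s \in S) (sconn : connected_avoiding F s t).

(** Induction on the rank in tree [j]: each step lowers it, unless the tree changes or a shared link
    lowers the depth below [D]. The bound [c] is passed to [switch] to locate the place of the next
    change. *)
Lemma delivered_unless_switched D j c :
  (forall m v i, pk m = (v, i) -> dp v < D -> delivered twin_scheme up s) ->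
  (forall m p f e, p \in S -> p != t -> f \in F -> nxt j p = Some f ->
     nxt (~~ j) p = Some e -> rk j p <= c -> dp p <= D ->
     connected_avoiding F p t -> pk m = (other_end p e, Some e) ->
     delivered twin_scheme up s) ->
  forall m v i, pk m = (v, i) -> tree_of_port v i = j -> rk j v <= c ->
    dp v <= D -> delivered twin_scheme up s.
Proof.
move=> shallow switch m v i.
have [b] := ubnP (rk j v); elim: b => // b IH in m v i * => vb pkm vj vc vD.
have := packet_connected m sS sconn; rewrite pkm /= => -[vS conn].
have [vt|vt] := eqVneq v t; first by exists m; rewrite pkm.
have [j' [e [stepE ne jj']]] := twin_step i vS vt conn (upF m).
rewrite vj in jj'.
have pkm1 : pk m.+1 = (other_end v e, Some e) by rewrite /= pkm stepE.
case: jj' => [j'E|[j'E [f fF nf]]]; rewrite {}j'E in ne; last first.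
  exact: (switch m.+1 v f e).
have [_ _ rw dw] := nxt_good vS vt ne.
case: (tree_of_nxt_or_dp vS vt ne) => [wj|ltd].
  apply: (IH m.+1 _ _ _ pkm1 wj).
  - exact: leq_trans rw vb.
  - exact: leq_trans (ltnW rw) vc.
  - exact: leq_trans dw vD.
exact: shallow pkm1 (leq_trans ltd vD).
Qed.

(** Within the induction on depth, [delivered_unless_switched] is applied three times, for the trees
    [j], [~~ j] and [j] again. *)
Lemma delivered_from D m v i :
  pk m = (v, i) -> dp v < D -> delivered twin_scheme up s.
Proof.
elim: D m v i => // D IH m v i pkm; rewrite ltnS => vD.
set j := tree_of_port v i.
apply: (delivered_unless_switched IH _ pkm (erefl j) (leqnn _) vD).
move: (j) => {m v i pkm vD}j m p f e pS pt fF npf npe _ pD pconn pkm.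
have [_ _ _ dw] := nxt_good pS pt npe.
have wj : tree_of_port (other_end p e) (Some e) = ~~ j.
  apply: (tree_of_nxt pS pt npe); rewrite negbK npf -npe eq_sym.
  exact: failed_nxt_neq npf.
apply: (delivered_unless_switched IH _ pkm wj (leqnn _) (leq_trans dw pD)).
move=> {m pkm wj dw} m q g e' qS qt gF nqg nqe' _ qD qconn pkm.
have {g gF nqg} nqf : nxt (~~ j) q = Some f.
  by have := gF; rewrite (failure_set1 fF) inE => /eqP <-.
rewrite negbK in nqe'.
have [pf _ rqp _] := nxt_good pS pt npf.
have [qf _ _ _] := nxt_good qS qt nqf.
have [_ _ rw dw] := nxt_good qS qt nqe'.
have nqj : nxt j q != Some f.
  by have := failed_nxt_neq qS qt qconn fF nqf; rewrite negbK.
have wj : tree_of_port (other_end q e') (Some e') = j.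
  by apply: (tree_of_nxt qS qt nqe'); rewrite nqf -nqe' eq_sym.
(* Both changes are due to the same link [f], and [q = p] would make [f] shared there. *)
have qE : q = other_end p f.
  by case: (incident_cases pf qf) => // qp; rewrite qp npf eqxx in nqj.
(* A third switch could only happen at [p], which is ranked above [q] in tree
   [j] because the link [f] leads from [p] to [q] there. *)
apply: (delivered_unless_switched IH _ pkm wj (leqnn _) (leq_trans dw qD)).
move=> m' p' g e'' p'S p't gF np'g _ rp' _ _ _.
have {g gF np'g} np'f : nxt j p' = Some f.
  by have := gF; rewrite (failure_set1 fF) inE => /eqP <-.
have [p'f _ _ _] := nxt_good p'S p't np'f.
have [p'E|p'E] := incident_cases pf p'f; last first.
  by rewrite p'E -qE in np'f; rewrite np'f eqxx in nqj.
by have := leq_ltn_trans rp' rw; rewrite p'E qE => /ltn_trans/(_ rqp); rewrite ltnn.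
Qed.

End Failure.

End Routing.

(** * Non-trapping and resilience of the scheme *)

Theorem theorem12 (G : multigraph) (t : vertex G) :
  exists R : routing_scheme t, non_trap R 1 /\ resilient R 1.
Proof.
have [S [nxt [rk [dp [T spanS]]]]] := exists_twin_trees t.
have inS F s : connected_avoiding F s t -> s \in S.
  move=> conn; apply: spanS; apply: connect_sub conn => u v /existsP[e].
  case/and3P=> _ ue /eqP<-; apply: connect1; apply: adjacent_other_end => //.
  by rewrite inE.
exists (twin_scheme t nxt); split=> F F1 s conn up upF.
  (* Source and current vertex are both connected to [t], hence to each other. *)
  move=> n; have [_] := packet_connected T F1 upF n (inS _ _ conn) conn.
  by rewrite connected_avoiding_sym; apply: connect_trans.
exact: (delivered_from T F1 upF (inS _ _ conn) conn (m := 0) (erefl _) (ltnSn _)).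
Qed.
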